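(* Let $D$ be a locally linear division ring with center $F$ and let $N$ be a subnormal subgroup of $D^*$. If $N$ is radical over $F$, then $N$ is central, i.e. $N\subseteq F$.
   Context: A division ring is centrally finite if it is a finite dimensional vector space over its center. A division ring is linear if it can be embedded in some centrally finite division ring. A division ring $D$ is locally linear if for every finite subset $S\subseteq D$ the division subring of $D$ generated by $S$ is linear. $D^*$ is the multiplicative group of $D$. A subgroup $N$ of $D^*$ is radical over $F$ if for every $x\in N$ there is a positive integer $n$ (depending on $x$) with $x^n\in F$. *)

(* Defs.v *)
From HB Require Import structures.
From mathcomp Require Import all_boot all_order all_algebra.
From mathcomp Require Import boolp classical_sets.

Set Implicit Arguments.
Unset Strict Implicit.
Unset Printing Implicit Defensive.

Import GRing.Theory.
Local Open Scope classical_set_scope.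
Local Open Scope ring_scope.

(* A [unitRingType] is associative, unital and nontrivial, but not assumed
   commutative. *)
Definition division_ring (D : unitRingType) : Prop :=
  forall x : D, x != 0 -> x \is a GRing.unit.

Definition center (D : unitRingType) : set D :=
  [set x | forall y : D, GRing.comm x y].
Arguments center : clear implicits.

(* [E] has a finite basis [b] over its center: every element has a unique
   expansion with central coefficients. *)
Definition centrally_finite (E : unitRingType) : Prop :=
  exists (n : nat) (b : 'I_n -> E), forall x : E,
    exists! c : {ffun 'I_n -> E},
      (forall i, center E (c i)) /\ x = \sum_(i < n) c i * b i.

(* Ring morphisms between division rings are automatically injective;
   injectivity is stated nonetheless. *)
Definition linear_divring (L : unitRingType) : Prop :=
  exists E : unitRingType, [/\ division_ring E, centrally_finite E &
    exists f : {rmorphism L -> E}, injective f].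

Section GeneratedDivisionSubring.
Variables (D : unitRingType) (S : seq D).

(* In a division ring, the subsets satisfying [divring_closed] (containing 1,
   stable under x - y and x / y) are exactly the division subrings, because
   0^-1 = 0. *)
Definition gen_divring : set D :=
  smallest (fun A : set D => divring_closed (mem A)) [set` S].

Definition gen_divring_pred : {pred D} := fun x => x \in gen_divring.

Lemma gen_divring_closed : divring_closed gen_divring_pred.
Proof.
split.
- by rewrite unfold_in; apply/mem_set => A [[A1 _ _] _]; apply/set_mem.
- move=> x y; rewrite !unfold_in => /set_mem gx /set_mem gy.
  apply/mem_set => A hA; have [[_ AB _] _] := hA.
  by apply/set_mem/AB; apply/mem_set; [apply: gx | apply: gy].
- move=> x y; rewrite !unfold_in => /set_mem gx /set_mem gy.
  apply/mem_set => A hA; have [[_ _ AV] _] := hA.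
  by apply/set_mem/AV; apply/mem_set; [apply: gx | apply: gy].
Qed.

HB.instance Definition _ :=
  GRing.isDivringClosed.Build D gen_divring_pred gen_divring_closed.

Definition gen_divring_type := {x : D | gen_divring_pred x}.

HB.instance Definition _ := SubChoice.on gen_divring_type.
HB.instance Definition _ :=
  [SubChoice_isSubUnitRing of gen_divring_type by <:].

End GeneratedDivisionSubring.

Definition locally_linear (D : unitRingType) : Prop :=
  forall S : seq D, linear_divring (gen_divring_type S).

Section SubnormalSubgroups.
Variable D : unitRingType.

Definition unit_group : set D := [set x | x \is a GRing.unit].

(* [divr_closed]: contains 1 and is stable under x / y. *)
Definition unit_subgroup (H : set D) : Prop :=
  H `<=` unit_group /\ divr_closed (mem H).

Definition normal_in (H K : set D) : Prop :=
  [/\ unit_subgroup H, unit_subgroup K, H `<=` K &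
      forall h k, H h -> K k -> H (k^-1 * h * k)].

(* There is a chain N = G 0 <| G 1 <| ... <| G r = D^*. *)
Definition subnormal (N : set D) : Prop :=
  exists (r : nat) (G : nat -> set D),
    [/\ G 0%N = N, G r = unit_group &
        forall i, (i < r)%N -> normal_in (G i) (G i.+1)].

Definition radical_over (N F : set D) : Prop :=
  forall x, N x -> exists n : nat, (0 < n)%N /\ F (x ^+ n).

End SubnormalSubgroups.

(* Main.v *)
(** Let [x] be in [N], put [th c = x c x^-1], and for [y] in [D^*] iterate
    [c_0 = y], [c_(k+1) = th (c_k) c_k^-1].  Descending the chain of subgroups
    shows [c_(r+1)] in [N] for every [y].  One may replace [D] by the division
    subring generated by [x] and an arbitrary [z]; being linear it is finite
    dimensional over its center [F], hence embeds in matrices over [F].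

    If some [s] in [F] is not integral over [Z], there is a valuation ring [O]
    of [F] missing [s] (Chevalley), and a suitable congruence subgroup, made of
    the elements congruent to 1 modulo [rho] over [O], is torsion free.  For
    [y = 1 + t z] with [t] in [F] small, all [th^i (c_k)] that matter lie in it.
    A power of [c_(r+1)] is central and [c_(r+1)] has determinant 1, so it is
    torsion, hence 1.  If [c_(k+2) = 1], then [v = c_(k+1)] is fixed by [th] and
    [th^j (c_k) = v^j c_k]; as [x^n] is central, [v^n = 1] and [v = 1].  Going
    down, [c_1 = 1], that is, [x] commutes with [y], hence with [z].

    Otherwise every element of [F] is integral over [Z], so [F] is algebraic
    over a finite field, [x] and [z] lie in a finite division ring, and
    Wedderburn's theorem applies. *)
Require Import Defs.
From HB Require Import structures.
From mathcomp Require Import all_boot all_order all_algebra finfield zify.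
From mathcomp Require Import boolp classical_sets.

Set Implicit Arguments.
Unset Strict Implicit.
Unset Printing Implicit Defensive.

Import GRing.Theory.
Local Open Scope classical_set_scope.
Local Open Scope ring_scope.

(** * The center of a division ring *)

Section CenterField.
Variables (D : unitRingType) (hD : division_ring D).

Definition center_pred : {pred D} := fun x => x \in center D.

Lemma center_predP x : reflect (forall y, GRing.comm x y) (x \in center_pred).
Proof. by apply: (iffP idP) => [/set_mem|?]; [|apply/mem_set]. Qed.

Fact center_divring_closed : divring_closed center_pred.
Proof.
split=> [|x y /center_predP cx /center_predP cy|x y /center_predP cx /center_predP cy];
  apply/center_predP => z; apply/commr_sym.
- exact: commr1.
- by apply: commrB; apply/commr_sym.
- by apply: commrM; [|apply: commrV]; apply/commr_sym.
Qed.

HB.instance Definition _ :=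
  GRing.isDivringClosed.Build D center_pred center_divring_closed.

(** Carrying [hD] as a parameter of the type lets the field structure, whose axiom depends on it, be
    declared canonically. *)
Definition center_field_type of division_ring D := {x : D | center_pred x}.
Local Notation F := (center_field_type hD).

HB.instance Definition _ := SubChoice.on F.
HB.instance Definition _ := [SubChoice_isSubUnitRing of F by <:].

Fact center_mulC : commutative (@GRing.mul F).
Proof. by move=> x y; apply/val_inj; rewrite !rmorphM /=; apply/center_predP/(valP x). Qed.

HB.instance Definition _ := GRing.PzRing_hasCommutativeMul.Build F center_mulC.

Fact center_fieldP : GRing.field_axiom F.
Proof.
move=> x; rewrite -(inj_eq val_inj) rmorph0 => /hD ux.
have cxV : center_pred (val x)^-1 by apply: rpredVr (valP x).
apply/unitrP; exists (Sub _ cxV : F).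
by split; apply/val_inj; rewrite rmorphM rmorph1 /= ?mulVr ?mulrV.
Qed.

HB.instance Definition _ := GRing.ComUnitRing_isField.Build F center_fieldP.

(** Later sections see the center only through [K] and [iota], so that scalars live in an abstract
    field over which matrices are available. *)
Lemma center_field :
  exists (K : fieldType) (iota : {rmorphism K -> D}), range iota = center D.
Proof.
exists F, (val : {rmorphism F -> D}).
apply/seteqP; split=> [x [a _ <-]|x cx]; first by apply/center_predP/(valP a).
have cx' : center_pred x by apply/mem_set.
by exists (Sub x cx' : F).
Qed.
End CenterField.

(** * Linear disjointness *)

Section LinearDisjointness.
Variables (D E : unitRingType) (K : fieldType).
Variables (iota : {rmorphism K -> D}) (f : {rmorphism D -> E}).
Hypotheses (hD : division_ring D) (iotaE : range iota = center D).

Lemma central_lift x : (forall y, GRing.comm x y) -> exists a, iota a = x.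
Proof.
move=> cx; have : center D x by [].
by rewrite -iotaE => -[a _ <-]; exists a.
Qed.

Lemma iota_comm a y : GRing.comm (iota a) y.
Proof. by have : center D (iota a) by rewrite -iotaE; exists a. Qed.

(* Shortest relation argument: normalize a coefficient [d m] to 1; commuting with [u] in [D]
   shortens the relation, unless all the coefficients are central. *)
Lemma centralizer_relation m (k : nat -> E) (d : nat -> D) :
    (forall i u, GRing.comm (k i) (f u)) ->
    (exists2 i, (i < m)%N & d i != 0) ->
    \sum_(i < m) k i * f (d i) = 0 ->
  exists2 c : nat -> K, exists2 i, (i < m)%N & c i != 0 &
    \sum_(i < m) k i * f (iota (c i)) = 0.
Proof.
move=> kC; elim: m d => [|m IHm] d; first by case.
case=> j lt_jm dj_neq0.
have extend : (exists2 c : nat -> K, exists2 i, (i < m)%N & c i != 0 &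
      \sum_(i < m) k i * f (iota (c i)) = 0) ->
    exists2 c : nat -> K, exists2 i, (i < m.+1)%N & c i != 0 &
      \sum_(i < m.+1) k i * f (iota (c i)) = 0.
  case=> c [i lt_im ci_neq0] sum0; exists (fun i => if (i < m)%N then c i else 0).
    by exists i; rewrite ?lt_im // ltnW.
  rewrite big_ord_recr /= ltnn !rmorph0 mulr0 addr0 -[RHS]sum0.
  by apply: eq_bigr => l _; rewrite ltn_ord.
have [dm0|dm_neq0] := eqVneq (d m) 0.
  rewrite big_ord_recr /= dm0 rmorph0 mulr0 addr0 => sum0; apply/extend/(IHm d) => //.
  exists j => //; move: lt_jm; rewrite ltnS leq_eqVlt => /orP[/eqP jm|//].
  by rewrite jm dm0 eqxx in dj_neq0.
move=> sum0; pose d' i := d i / d m.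
have d'm : d' m = 1 by rewrite /d' divrr // hD.
have {}sum0 : \sum_(i < m.+1) k i * f (d' i) = 0.
  have /= := congr1 (fun x => x * f (d m)^-1) sum0; rewrite mul0r => {}sum0.
  rewrite -[RHS]sum0 mulr_suml.
  by apply: eq_bigr => i _; rewrite /d' rmorphM mulrA.
have [[u [i lt_im ui_neq]]|d'C] :=
    pselect (exists u, exists2 i, (i < m)%N & u * d' i - d' i * u != 0).
  apply/extend/(IHm (fun i => u * d' i - d' i * u)); first by exists i.
  have: \sum_(i < m.+1) k i * f (u * d' i - d' i * u) = 0.
    transitivity (f u * (\sum_(i < m.+1) k i * f (d' i)) -
      (\sum_(i < m.+1) k i * f (d' i)) * f u); last by rewrite sum0 mul0r mulr0 subr0.
    rewrite mulr_suml mulr_sumr -sumrB; apply: eq_bigr => l _.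
    by rewrite rmorphB !rmorphM mulrBr !mulrA (kC l u).
  by rewrite big_ord_recr /= d'm mulr1 mul1r subrr rmorph0 mulr0 addr0.
have /choice [c cE] : forall i, exists a, (i < m.+1)%N -> iota a = d' i.
  move=> i; have [lt_im|] := boolP (i < m.+1)%N; last by exists 0.
  suff /central_lift [a aE] : forall y, GRing.comm (d' i) y by exists a.
  move=> u; move: lt_im; rewrite ltnS leq_eqVlt => /orP[/eqP ->|lt_im].
    by rewrite d'm; apply/commr_sym/commr1.
  apply/esym/eqP; rewrite -subr_eq0; apply/negPn/negP => neq.
  by apply: d'C; exists u, i.
exists c; last first.
  by rewrite -[RHS]sum0; apply: eq_bigr => i _; rewrite cE.
by exists m => //; rewrite -(fmorph_eq0 iota) ?cE // d'm oner_eq0.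
Qed.

(** The centralizer of the image of [f] is linearly disjoint from [D] over the center.
    [centralizer_relation] gives a relation over [K] among the [k i]; solving it for one [k p] and
    substituting leaves a shorter relation in the elements [d i - iota (e i) * d p]. *)
Lemma centralizer_dependent m (k : 'I_m -> E) (d : 'I_m -> D) :
    (forall i u, GRing.comm (k i) (f u)) -> (exists i, k i != 0) ->
    \sum_i k i * f (d i) = 0 ->
  exists2 c : 'I_m -> K, exists i, c i != 0 & \sum_i iota (c i) * d i = 0.
Proof.
elim: m k d => [|m IHm] k d kC; first by case=> -[].
case=> i0 ki0 sum0.
have [[j dj]|/forallNP d0] := pselect (exists j, d j != 0); last first.
  exists (fun=> 1); first by exists i0; rewrite oner_eq0.
  by rewrite big1 // => i _; have /negP/negPn/eqP -> := d0 i; rewrite mulr0.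
pose kk i := k (inord i); pose dd i := d (inord i).
have [c [l lt_lm cl] sumc] : exists2 c : nat -> K, exists2 i, (i < m.+1)%N & c i != 0 &
    \sum_(i < m.+1) kk i * f (iota (c i)) = 0.
  apply: (@centralizer_relation _ kk dd).
  - by move=> i u; apply: kC.
  - by exists (val j); rewrite ?ltn_ord // /dd inord_val.
  - by rewrite -[RHS]sum0; apply: eq_bigr => i _; rewrite /kk /dd inord_val.
pose p : 'I_m.+1 := Ordinal lt_lm.
pose e i := c (lift p i) / c p.
have kp : k p = - \sum_i k (lift p i) * f (iota (e i)).
  have cpU : f (iota (c p)) \is a GRing.unit by rewrite !rmorph_unit ?unitfE.
  apply: (mulIr cpU); rewrite mulNr mulr_suml; apply/eqP.
  rewrite -addr_eq0 -[X in _ == X]sumc.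
  rewrite [X in _ == X](bigD1_ord p) // /kk inord_val; apply/eqP; congr (_ + _).
  apply: eq_bigr => i _; rewrite -mulrA -!rmorphM /e divfK //.
  by rewrite inord_val.
have [|||c' [q c'q] sumc'] := IHm (k \o lift p) (fun i => d (lift p i) - iota (e i) * d p).
- by move=> i u; apply: kC.
(* If all remaining [k i] were zero, [kp] would make [k p] vanish too, against [ki0]. *)
- apply: contrapT => /forallNP k0; case/negP: ki0; apply/eqP.
  have k0' i : k (lift p i) = 0 by have /negP/negPn/eqP := k0 i.
  case: (unliftP p i0) => [i ->|->] //.
  by rewrite kp big1 ?oppr0 // => i _; rewrite k0' mul0r.
- rewrite -[RHS]sum0 (bigD1_ord p) //= kp mulNr mulr_suml addrC -sumrB.
  by apply: eq_bigr => i _; rewrite rmorphB mulrBr rmorphM mulrA.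
exists (fun i => if unlift p i is Some i' then c' i' else - \sum_i c' i * e i).
  by exists (lift p q); rewrite liftK.
rewrite (bigD1_ord p) //= unlift_none rmorphN rmorph_sum mulNr mulr_suml addrC.
rewrite -[RHS]sumc' -sumrB; apply: eq_bigr => i _.
by rewrite liftK mulrBr rmorphM mulrA.
Qed.
End LinearDisjointness.

(** * The regular representation *)

Section RegularRepresentation.
Variables (D : unitRingType) (K : fieldType) (iota : {rmorphism K -> D}).
Hypotheses (hD : division_ring D) (iotaE : range iota = center D).

Definition central_free m (d : 'I_m -> D) :=
  forall c : 'I_m -> K, \sum_i iota (c i) * d i = 0 -> forall i, c i = 0.

(** The bound is the dimension of [E] over its own center. A longer family has dependent coordinate
    rows there; the coefficients of that dependence are central in [E], hence centralize the image
    of [f], and [centralizer_dependent] brings the relation down to [K]. *)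
Lemma linear_bounded_free :
  linear_divring D -> exists n, forall m (d : 'I_m -> D), central_free d -> (m <= n)%N.
Proof.
case=> E [hE [n [b bE]] [f _]]; exists n => m d dfree; rewrite leqNgt; apply/negP => lt_nm.
have [K' [kappa kappaE]] := center_field hE.
have /choice [M ME] : forall i, exists r : 'I_n -> K', f (d i) = \sum_j kappa (r j) * b j.
  move=> i; have [c [[cC fdi] _]] := bE (f (d i)).
  have /choice [r rE] : forall j, exists a, kappa a = c j.
    by move=> j; apply: (central_lift kappaE); apply: cC.
  by exists r; rewrite fdi; apply: eq_bigr => j _; rewrite rE.
pose A := \matrix_(i, j) M i j.
have /rowV0Pn [v /sub_kermxP vA v_neq0] : kermx A != 0.
  by rewrite -mxrank_eq0 mxrank_ker subn_eq0 -ltnNge (leq_ltn_trans (rank_leq_col _)).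
have [i vi] : exists i, v 0 i != 0 by apply/rV0Pn.
have [|||c [j /eqP cj] sumc] :=
  @centralizer_dependent D E K iota f hD iotaE m (fun i => kappa (v 0 i)) d.
- by move=> l u; apply: iota_comm.
- by exists i; rewrite fmorph_eq0.
- transitivity (\sum_j kappa ((v *m A) 0 j) * b j).
    under eq_bigr do rewrite ME mulr_sumr.
    rewrite exchange_big; apply: eq_bigr => l _; rewrite mxE rmorph_sum mulr_suml.
    by apply: eq_bigr => q _; rewrite mxE rmorphM mulrA.
  by rewrite vA big1 // => l _; rewrite mxE rmorph0 mul0r.
by apply: cj; apply: (dfree c).
Qed.

(** A free family of maximal length spans: adding [x] breaks freeness, necessarily with a nonzero
    coefficient at [x]. *)
Lemma linear_central_basis : linear_divring D ->
  exists m (d : 'I_m -> D), central_free d /\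
    forall x, exists c : 'I_m -> K, x = \sum_i iota (c i) * d i.
Proof.
move=> /linear_bounded_free [n leqn].
pose P m := `[< exists d : 'I_m -> D, central_free d >].
have exP : exists m, P m by exists 0%N; apply/asboolP; exists (fun=> 0) => c _ [].
have leP m : P m -> (m <= n)%N by case/asboolP => d /leqn.
case: (ex_maxnP exP leP) => m /asboolP [d dfree] mmax; exists m, d; split=> // x.
pose d' (i : 'I_m.+1) := if unlift ord_max i is Some j then d j else x.
have sumd' c : \sum_i iota (c i) * d' i =
    iota (c ord_max) * x + \sum_i iota (c (lift ord_max i)) * d i.
  rewrite (bigD1_ord ord_max) //= /d' unlift_none; congr (_ + _).
  by apply: eq_bigr => i _; rewrite liftK.
have : ~ central_free d'.
  move=> d'free; have /mmax : P m.+1 by apply/asboolP; exists d'.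
  by rewrite ltnn.
move=> /existsNP [c /not_implyP [sumc /existsNP [i /eqP ci]]].
rewrite sumd' in sumc.
have cmax : c ord_max != 0.
  apply: contra ci => /eqP c0; rewrite c0 rmorph0 mul0r add0r in sumc.
  case: (unliftP ord_max i) => [j ->|->]; last by rewrite c0.
  by rewrite (dfree (fun i => c (lift ord_max i))).
exists (fun i => - (c ord_max)^-1 * c (lift ord_max i)).
have cU : iota (c ord_max) \is a GRing.unit by rewrite rmorph_unit ?unitfE.
apply: (mulrI cU); apply/eqP; rewrite -subr_eq0 -[X in _ == X]sumc mulr_sumr -sumrN.
apply/eqP; congr (_ + _); apply: eq_bigr => j _.
by rewrite mulrA -rmorphM mulNr mulrN mulVKf // rmorphN mulNr opprK.
Qed.

(** Row [i] of [L u] lists the coordinates of [d i * u]; acting from the right makes [L] preserve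
    the order of products. *)
Lemma linear_regular_rep : linear_divring D ->
  exists n (L : {rmorphism D -> 'M[K]_n.+1}), forall a, L (iota a) = a%:M.
Proof.
(* An empty basis would force [1 = 0]. *)
move=> /linear_central_basis [[|n] [d [dfree dspan]]].
  by have [c /eqP] := dspan 1; rewrite big_ord0 oner_eq0.
have /choice [co coE] := dspan.
have coU x c : x = \sum_i iota (c i) * d i -> co x = c.
  move=> xE; apply/funext => i; apply/eqP; rewrite -subr_eq0; apply/eqP.
  have e := coE x; rewrite {1}xE in e.
  apply: (dfree (fun i => co x i - c i)).
  by under eq_bigr do rewrite rmorphB mulrBl; rewrite sumrB e subrr.
pose L u : 'M[K]_n.+1 := \matrix_(i, j) co (d i * u) j.
have LE u i : d i * u = \sum_j iota (L u i j) * d j.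
  by rewrite {1}(coE (d i * u)); apply: eq_bigr => j _; rewrite mxE.
have LU u (A : 'M[K]_n.+1) : (forall i, d i * u = \sum_j iota (A i j) * d j) -> L u = A.
  by move=> uA; apply/matrixP => i j; rewrite mxE (coU _ _ (uA i)).
have LB : zmod_morphism L.
  move=> u v; apply: LU => i; rewrite mulrBr !LE -sumrB.
  by apply: eq_bigr => j _; rewrite !mxE rmorphB mulrBl.
have LM : monoid_morphism L.
  split=> [|u v].
    apply: LU => i; rewrite mulr1 (bigD1 i) //= mxE eqxx rmorph1 mul1r big1 ?addr0 // => j.
    by rewrite eq_sym mxE => /negPf ->; rewrite rmorph0 mul0r.
  apply: LU => i; rewrite mulrA LE mulr_suml.
  under eq_bigr do rewrite -mulrA LE mulr_sumr.
  rewrite exchange_big; apply: eq_bigr => j _; rewrite mxE rmorph_sum mulr_suml.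
  by apply: eq_bigr => l _; rewrite rmorphM mulrA.
pose bL := GRing.isZmodMorphism.Build _ _ L LB.
pose mL := GRing.isMonoidMorphism.Build _ _ L LM.
pose rL : {rmorphism _ -> _} := HB.pack L bL mL.
exists n, rL => a; apply: LU => i.
rewrite (bigD1 i) //= mxE eqxx big1 ?addr0 => [|j]; first by rewrite iota_comm.
by rewrite eq_sym mxE => /negPf ->; rewrite rmorph0 mul0r.
Qed.
End RegularRepresentation.

(** * Valuation rings *)

Section ValuationRings.
Variable F : fieldType.
Implicit Types (A O : set F) (s f x y : F).

Definition is_subring A := [/\ A 1, forall x y, A x -> A y -> A (x - y) &
  forall x y, A x -> A y -> A (x * y)].

Definition valuation_ring O := is_subring O /\ forall x, O x \/ O x^-1.

Section SubringTheory.
Variables (A : set F) (sA : is_subring A).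

Lemma subring1 : A 1. Proof. by case: sA. Qed.
Lemma subringB x y : A x -> A y -> A (x - y). Proof. by case: sA => _ + _; apply. Qed.
Lemma subringM x y : A x -> A y -> A (x * y). Proof. by case: sA => _ _; apply. Qed.
Lemma subring0 : A 0. Proof. by rewrite -(subrr 1); apply: subringB subring1 subring1. Qed.
Lemma subringN x : A x -> A (- x).
Proof. by rewrite -sub0r; apply: subringB subring0. Qed.
Lemma subringD x y : A x -> A y -> A (x + y).
Proof. by move=> Ax Ay; rewrite -[y]opprK; apply/subringB/subringN. Qed.
Lemma subring_sum I (r : seq I) (P : pred I) (G : I -> F) :
  (forall i, P i -> A (G i)) -> A (\sum_(i <- r | P i) G i).
Proof. by move=> AG; apply: (big_ind A) => //; [apply: subring0 | apply: subringD]. Qed.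
Lemma subringX x n : A x -> A (x ^+ n).
Proof.
move=> Ax; elim: n => [|n IHn]; first by rewrite expr0; apply: subring1.
by rewrite exprS; apply: subringM.
Qed.
Lemma subring_nat n : A n%:R.
Proof.
elim: n => [|n IHn]; first exact: subring0.
by rewrite mulrS; apply: subringD IHn; apply: subring1.
Qed.

Definition adjoin f := [set x | exists p : {poly F}, (forall i, A p`_i) /\ x = p.[f]].

Lemma adjoin_subring f : is_subring (adjoin f).
Proof.
split=> [|_ _ [p [Ap ->]] [q [Aq ->]]|_ _ [p [Ap ->]] [q [Aq ->]]].
- exists 1; split=> [i|]; last by rewrite hornerC.
  by rewrite coef1; case: eqP => _; [apply: subring1 | apply: subring0].
- exists (p - q); split=> [i|]; last by rewrite !hornerE.
  by rewrite coefB; apply: subringB.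
- exists (p * q); split=> [i|]; last by rewrite hornerM.
  by rewrite coefM; apply: subring_sum => j _; apply: subringM.
Qed.

Lemma sub_adjoin f : A `<=` adjoin f.
Proof.
move=> x Ax; exists x%:P; split=> [i|]; last by rewrite hornerC.
by rewrite coefC; case: eqP => // _; apply: subring0.
Qed.

Lemma mem_adjoin f : adjoin f f.
Proof.
exists 'X; split=> [i|]; last by rewrite hornerX.
by rewrite coefX; case: eqP => _; [apply: subring1 | apply: subring0].
Qed.
End SubringTheory.

Lemma maximal_subring_avoiding s A0 : is_subring A0 -> ~ A0 s ->
  exists O, [/\ is_subring O, A0 `<=` O, ~ O s &
    forall B, is_subring B -> O `<=` B -> ~ B s -> B `<=` O].
Proof.
move=> sA0 nA0s; pose good A := [/\ is_subring A, A0 `<=` A & ~ A s].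
(* [set0] is allowed because [Zorn_bigcup] also takes the union of the empty chain *)
have [C CP Ctot|O [Ogood Omax]] := @Zorn_bigcup F (fun A => A !=set0 -> good A).
  case=> x0 [X0 CX0 X0x0]; have gX X x : C X -> X x -> good X.
    by move=> CX Xx; apply: (CP X CX); exists x.
  have both x y : (\bigcup_(X in C) X) x -> (\bigcup_(X in C) X) y ->
      exists X, [/\ C X, good X, X x & X y].
    move=> [X CX Xx] [Y CY Yy]; case: (Ctot X Y CX CY) => [XY|YX].
      by exists Y; split; [|exact: (gX Y y)|exact: XY|].
    by exists X; split; [|exact: (gX X x)| |exact: YX].
  have [sX0 A0X0 _] := gX _ _ CX0 X0x0; split; first split.
  - by exists X0 => //; apply: subring1.
  - by move=> x y /both/[apply] -[X [CX [sX _ _] Xx Xy]]; exists X => //; apply: subringB.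
  - by move=> x y /both/[apply] -[X [CX [sX _ _] Xx Xy]]; exists X => //; apply: subringM.
  - by move=> x /A0X0; exists X0.
  - by case=> X CX Xs; have [] := gX X s CX Xs.
have [sO A0O nOs] : good O.
  apply: Ogood; apply/set0P/negP => /eqP O0; apply: (Omax A0) => [|_]; last by split.
  by rewrite O0; split=> // /(_ 1 (subring1 sA0)).
exists O; split=> // B sB OB nBs.
have [//|nBO] := pselect (B `<=` O); case: (Omax B) => [//|_].
by split=> //; apply: subset_trans OB.
Qed.

(** * Chevalley's theorem: a maximal subring avoiding [s] is a valuation ring *)

Section Chevalley.
Variables (s : F) (O : set F).
Hypotheses (sO : is_subring O) (nOs : ~ O s) (Opi : O s^-1).
Hypothesis Omax : forall B, is_subring B -> O `<=` B -> ~ B s -> B `<=` O.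

Let s_neq0 : s != 0.
Proof. by apply/eqP => s0; apply: nOs; rewrite s0; apply: subring0. Qed.

Let adjoin_max f : ~ O f -> adjoin O f s.
Proof.
move=> nOf; apply: contrapT => nfs; apply: nOf.
by apply: (Omax (adjoin_subring sO f) (sub_adjoin sO f) nfs); apply: mem_adjoin.
Qed.

(** So [s^-1] lies in the Jacobson radical of [O]. If [u^-1] were outside [O], maximality would make
    [s] a polynomial in [u^-1] over [O], and clearing denominators would put some [s * u ^+ k] in
    [O]. *)
Let sub1_unit b : O b -> 1 - s^-1 * b != 0 /\ O (1 - s^-1 * b)^-1.
Proof.
move=> Ob; set u := 1 - _.
have su : s * u = s - b by rewrite mulrBr mulr1 mulVKf.
have u_neq0 : u != 0.
  apply/eqP => u0; move: su; rewrite u0 mulr0 => /esym/eqP; rewrite subr_eq0 => /eqP sb.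
  by apply: nOs; rewrite sb.
have Ou : O u by apply: subringB (subringM _ _ _) => //; apply: subring1.
split=> //; apply: contrapT => /adjoin_max [p [Op sE]]; apply: nOs.
have : O (s * u ^+ (size p)).
  rewrite sE horner_coef mulr_suml; apply: subring_sum => // i _.
  rewrite exprVn -mulrA; apply: subringM => //.
  by rewrite mulrC -expfB //; apply: subringX.
(* As [s * u = s - b], the factors [u] are removed one at a time, each at the cost of an element of
   [O], until [s] itself remains. *)
elim: (size p) => [|k IHk]; first by rewrite mulr1.
rewrite exprS mulrA su mulrBl => Osb; apply: IHk.
rewrite -[s * _](subrK (b * u ^+ k)); apply: subringD => //.
by apply: subringM => //; apply: subringX.
Qed.

(* The relation for [f^-1] rewrites [f ^+ n] as a polynomial in [f] of degree less than [n],
   which lowers the degree of the relation for [f]. *)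
Let chevalley_step f m n (p q : {poly F}) : f != 0 -> (n <= m)%N ->
    (forall i, O p`_i) -> (size p <= m.+1)%N -> s = p.[f] ->
    (forall i, O q`_i) -> (size q <= n.+1)%N -> s = q.[f^-1] ->
  exists p' : {poly F}, [/\ forall i, O p'`_i, (size p' <= m)%N & s = p'.[f]].
Proof.
move=> f_neq0 le_nm Op sp sE Oq sq sE'.
have [v_neq0 Ov] := sub1_unit (Oq 0%N); set v := 1 - _ in v_neq0 Ov.
(* Multiply [s = q.[f^-1]] by [s^-1 * f ^+ n] and move the constant term of [q] to the left: this
   leaves [v * f ^+ n], and [v] is a unit of [O]. *)
pose g := \poly_(i < n) (s^-1 * v^-1 * q`_(n - i)).
have Og i : O g`_i.
  rewrite coef_poly; case: ifP => _; last exact: subring0.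
  by do 2?apply: subringM.
have gE : g.[f] = f ^+ n.
  apply: (mulfI v_neq0); rewrite /g horner_poly mulr_sumr.
  have fE : f ^+ n = s^-1 * \sum_(i < n.+1) q`_(n - i) * f ^+ i.
    apply: (mulfI s_neq0); rewrite mulVKf // {1}sE' (horner_coef_wide _ sq) mulr_suml.
    rewrite [RHS](reindex_inj rev_ord_inj) /=; apply: eq_bigr => i _.
    have le_in : (i <= n)%N by rewrite -ltnS.
    rewrite subSS subKn // -mulrA; congr (_ * _).
    by rewrite expfB_cond ?(negPf f_neq0) // mulrC exprVn.
  have -> : v * f ^+ n = f ^+ n - s^-1 * q`_0 * f ^+ n by rewrite mulrBl mul1r.
  rewrite {1}fE big_ord_recr /= subnn mulrDr mulrA addrK mulr_sumr.
  by apply: eq_bigr => i _; rewrite !mulrA [v * _]mulrC mulfK // mulrAC.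
pose p' := p - p`_m *: 'X^m + p`_m *: ('X^(m - n) * g).
exists p'; split=> [i||].
- rewrite coefD coefB !coefZ coefXn coefXnM; apply: subringD => //.
    apply: subringB => //; apply: subringM => //.
    by case: eqP => _; [apply: subring1 | apply: subring0].
  by apply: subringM => //; case: ifP => _ //; apply: subring0.
- apply/leq_sizeP => i le_mi; rewrite coefD coefB !coefZ coefXn coefXnM.
  rewrite ltnNge (leq_trans (leq_subr _ _) le_mi) /= coef_poly.
  have /negPf -> : ~~ (i - (m - n) < n)%N.
    by rewrite -leqNgt leq_subRL ?subnK // (leq_trans (leq_subr _ _)).
  rewrite mulr0 addr0; case: eqP => [->|/eqP neq]; first by rewrite mulr1 subrr.
  by rewrite mulr0 subr0 nth_default // (leq_trans sp) // ltn_neqAle eq_sym neq.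
- by rewrite /p' !(hornerD, hornerN, hornerZ, hornerM, hornerXn) gE -exprD subnK // subrK.
Qed.

Let adjoin_size f : ~ O f ->
  exists2 m, exists p : {poly F}, [/\ forall i, O p`_i, (size p <= m.+1)%N & s = p.[f]]
  & forall p : {poly F}, (forall i, O p`_i) -> s = p.[f] -> (m < size p)%N.
Proof.
move=> /adjoin_max [p0 [Op0 sE0]].
pose P k := `[< exists p : {poly F}, [/\ forall i, O p`_i, (size p <= k)%N & s = p.[f]] >].
have exP : exists k, P k by exists (size p0); apply/asboolP; exists p0.
case: (ex_minnP exP) => -[|m] /asboolP [p [Op sp sE]] mmin.
  move: sp s_neq0; rewrite sE leqn0 size_poly_eq0 => /eqP ->.
  by rewrite horner0 eqxx.
exists m; first by exists p.
by move=> q Oq sEq; apply: mmin; apply/asboolP; exists q.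
Qed.

(** If [O] misses both [f] and [f^-1], then [s] is a polynomial in each of them over [O]. With both
    degrees minimal, [chevalley_step] lowers the larger one, a contradiction. *)
Lemma maximal_avoiding_valuation : valuation_ring O.
Proof.
split=> // f; apply: contrapT => /not_orP [nOf nOfV].
have f_neq0 : f != 0 by apply/eqP => f0; apply: nOf; rewrite f0; apply: subring0.
have [m [p [Op sp sE]] pmin] := adjoin_size nOf.
have [n [q [Oq sq sEq]] qmin] := adjoin_size nOfV.
case: (leqP n m) => [le_nm|/ltnW le_mn].
  have [p' [Op' sp' sE']] := chevalley_step f_neq0 le_nm Op sp sE Oq sq sEq.
  by have := pmin p' Op' sE'; rewrite ltnNge sp'.
have fV_neq0 : f^-1 != 0 by rewrite invr_eq0.
have [|q' [Oq' sq' sE']] := chevalley_step fV_neq0 le_mn Oq sq sEq Op sp.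
  by rewrite invrK.
by have := qmin q' Oq' sE'; rewrite ltnNge sq'.
Qed.
End Chevalley.

(* [s] is integral over the image of [int] iff it lies in the ring generated by [s^-1]. *)
Definition nonintegral s := forall q : {poly int}, s <> (map_poly intr q).[s^-1].

(** Nonintegrality says that [A0], the ring generated by [s^-1], misses [s]; a maximal subring above
    it contains [s^-1], as Chevalley's argument requires. *)
Lemma nonintegral_valuation s : nonintegral s -> exists2 O, valuation_ring O & ~ O s.
Proof.
move=> sNint.
pose A0 := [set x | exists q : {poly int}, x = (map_poly intr q).[s^-1]].
have sA0 : is_subring A0.
  split=> [|_ _ [p ->] [q ->]|_ _ [p ->] [q ->]].
  - by exists 1; rewrite rmorph1 hornerC.
  - by exists (p - q); rewrite rmorphB !hornerE.
  - by exists (p * q); rewrite rmorphM hornerM.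
have [|O [sO A0O nOs Omax]] := maximal_subring_avoiding sA0 (s := s).
  by case=> q; apply: sNint.
exists O => //; apply: maximal_avoiding_valuation nOs _ Omax => //.
by apply: A0O; exists 'X; rewrite map_polyX hornerX.
Qed.

(** Here [rho] is a nonunit of [O] and [x] a multiple of it. As [(1 + x) / rho] differs from
    [rho^-1] by an element of [O], it is outside [O], so its inverse is inside; then [(1 + x)^-1 = 1
    - (x / rho) * (rho / (1 + x))]. *)
Lemma valuation_unit O rho x : valuation_ring O -> ~ O rho^-1 -> O (x / rho) ->
  1 + x != 0 /\ O (1 + x)^-1.
Proof.
move=> [sO vO] nOrho Oc; set c := x / rho in Oc.
have rho_neq0 : rho != 0.
  by apply/eqP => rho0; apply: nOrho; rewrite rho0 invr0; apply: subring0.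
have uE : (1 + x) / rho = rho^-1 + c by rewrite mulrDl mul1r.
have nOu : ~ O ((1 + x) / rho).
  by rewrite uE => Ou; apply: nOrho; rewrite -[rho^-1](addrK c); apply: subringB.
have u_neq0 : 1 + x != 0.
  by apply/eqP => u0; apply: nOu; rewrite u0 mul0r; apply: subring0.
split=> //; have [//|] := vO ((1 + x) / rho); rewrite invf_div => Ou.
suff -> : (1 + x)^-1 = 1 - c * (rho / (1 + x)).
  by apply: subringB (subringM _ _ _) => //; apply: subring1.
rewrite /c mulrA divfK //; apply: (mulIf u_neq0).
by rewrite mulVf // mulrBl mul1r divfK // addrK.
Qed.

(* If some prime [p] is not invertible in [O], take [rho = p ^+ 2] to get [p / rho] out of [O];
   otherwise [rho = s^-1] works. *)
Lemma valuation_modulus O s : valuation_ring O -> ~ O s ->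
  exists2 rho, ~ O rho^-1 & forall l, prime l -> l%:R != 0 :> F -> ~ O (l%:R / rho).
Proof.
move=> [sO vO] nOs.
have [[p [p_pr p_neq0 nOp]]|none] :=
    pselect (exists p, [/\ prime p, p%:R != 0 :> F & ~ O p%:R^-1]); last first.
  exists s^-1; rewrite ?invrK // => l l_pr l_neq0 Ols; apply: none.
  exists l; split=> // Ol; apply: nOs.
  by rewrite -(mulKf l_neq0 s); apply: (subringM sO).
have divp x : O (x / p%:R ^+ 2) -> O (x / p%:R).
  move=> Ox; rewrite -[x / _](_ : x / p%:R ^+ 2 * p%:R = _); last first.
    by rewrite expr2 invfM mulrA divfK.
  by apply: subringM => //; apply: subring_nat.
exists (p%:R ^+ 2) => [Op2|l l_pr l_neq0].
  by apply: nOp; have := divp 1; rewrite !mul1r; apply.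
have [->|neq_lp] := eqVneq l p; first by rewrite expr2 invfM mulrA divff ?mul1r.
(* A Bezout relation [1 + a * l = k * p] would turn [l / p] in [O] into [p^-1] in [O]. *)
move=> /divp Olp; apply: nOp.
have [a _ /dvdnP [k]] := Bezoutl l (prime_gt0 p_pr).
have /eqP -> : coprime p l by rewrite prime_coprime // dvdn_prime2 // eq_sym.
move/(congr1 (fun n => n%:R : F)); rewrite natrD !natrM => bez.
have -> : p%:R^-1 = k%:R - a%:R * (l%:R / p%:R) :> F.
  by apply: (mulIf p_neq0); rewrite mulVf // mulrBl -bez mulrA divfK // addrK.
by apply: subringB (subringM _ _ _) => //; apply: subring_nat.
Qed.
End ValuationRings.

Lemma valuation_denominator (F : fieldType) (O : set F) (s : seq F) : valuation_ring O ->
  exists2 t, t != 0 & O t /\ forall f, f \in s -> O (t * f).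
Proof.
move=> [sO vO]; elim: s => [|f s [t t_neq0 [Ot ts]]].
  by exists 1; rewrite ?oner_eq0; split=> //; apply: subring1.
have [u u_neq0 [Ou Ouf]] : exists2 u, u != 0 & O u /\ O (u * f).
  have [Of|OfV] := vO f.
    by exists 1; rewrite ?oner_eq0 ?mul1r; split=> //; apply: subring1.
  have [->|f_neq0] := eqVneq f 0.
    by exists 1; rewrite ?oner_eq0 ?mulr0; split=> //; [apply: subring1|apply: subring0].
  by exists f^-1; rewrite ?invr_eq0 ?mulVf //; split=> //; apply: subring1.
exists (t * u); first by rewrite mulf_neq0.
split=> [|g]; first exact: subringM.
rewrite inE => /orP[/eqP ->|gs]; first by rewrite -mulrA; apply: subringM.
by rewrite mulrAC; apply: subringM => //; apply: ts.
Qed.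

(** * Congruence subgroups *)

Section CongruenceSubgroup.
Variables (D : unitRingType) (F : fieldType) (n : nat).
Variables (L : {rmorphism D -> 'M[F]_n.+1}) (O : set F) (rho : F).
Hypotheses (hD : division_ring D) (vO : valuation_ring O) (nOrho : ~ O rho^-1).

Let sO : is_subring O. Proof. by case: vO. Qed.
Let Orho : O rho. Proof. by case: vO => _ /(_ rho) []. Qed.
Let rho_neq0 : rho != 0.
Proof. by apply/eqP => r0; apply: nOrho; rewrite r0 invr0; apply: subring0. Qed.

Let Odiv x : O (x / rho) -> O x.
Proof. by move=> Ox; rewrite -[x](divfK rho_neq0); apply: subringM. Qed.

(** For nonzero [rho], [O (a / rho)] expresses that [a] lies in the ideal [rho O]. *)
Definition congr_one (A : 'M[F]_n.+1) := forall i j, O ((A - 1%:M) i j / rho).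

Definition congr_subgroup : set D := [set u | congr_one (L u)].
Local Notation Gamma := congr_subgroup.

Lemma congr_one_integral A i j : congr_one A -> O (A i j).
Proof.
move=> /(_ i j)/Odiv; rewrite !mxE => OA; rewrite -[A i j](subrK (i == j)%:R).
by apply: subringD => //; apply: subring_nat.
Qed.

Lemma det_integral m (A : 'M[F]_m) : (forall i j, O (A i j)) -> O (\det A).
Proof.
move=> OA; apply: subring_sum => // s _; apply: subringM => //.
  by apply: subringX => //; apply: subringN => //; apply: subring1.
by apply: (big_ind O) => //; [apply: subring1 | apply: subringM].
Qed.

(** Congruence modulo [rho] between elements of [O] respects sums and products, so it passes through
    the Leibniz expansion. *)
Lemma det_congr_one A : congr_one A -> O ((\det A - 1) / rho).
Proof.
move=> cA; have OA i j := congr_one_integral i j cA.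
pose K x y := [/\ O x, O y & O ((x - y) / rho)].
suff [] : K (\det A) (\det (1%:M : 'M[F]_n.+1)) by rewrite det1.
have Kid x : O x -> K x x by move=> Ox; split; rewrite // subrr mul0r; apply: subring0.
have K1 i j : K (A i j) ((1%:M : 'M[F]_n.+1) i j).
  by split=> //; [rewrite mxE; apply: subring_nat | have := cA i j; rewrite !mxE].
have KM x y z t : K x y -> K z t -> K (x * z) (y * t).
  move=> [Ox Oy Oxy] [Oz Ot Ozt]; split; try exact: subringM.
  have -> : (x * z - y * t) / rho = (x - y) / rho * z + y * ((z - t) / rho).
    rewrite [_ / _ * z]mulrAC [y * (_ / _)]mulrA -mulrDl; congr (_ / _).
    by rewrite mulrBl mulrBr addrA subrK.
  by apply: subringD => //; apply: subringM.
have KD x y z t : K x y -> K z t -> K (x + z) (y + t).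
  move=> [Ox Oy Oxy] [Oz Ot Ozt]; split; try exact: subringD.
  by rewrite opprD addrACA mulrDl; apply: subringD.
apply: (big_ind2 K _ KD) => [|s _]; first by apply: (Kid); apply: subring0 sO.
apply: (KM).
  by apply: (Kid); apply: subringX (subringN _ _) => //; apply: subring1 sO.
by apply: (big_ind2 K _ KM) => // ; apply: Kid; apply: subring1 sO.
Qed.

Lemma congr_subgroup1 : Gamma 1.
Proof. by move=> i j; rewrite rmorph1 subrr mxE mul0r; apply: subring0. Qed.

Lemma congr_subgroupM u v : Gamma u -> Gamma v -> Gamma (u * v).
Proof.
move=> Gu Gv i j; rewrite rmorphM.
have -> : L u * L v - 1%:M = L u *m (L v - 1%:M) + (L u - 1%:M).
  by rewrite mulmxBr mulmx1 addrA subrK.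
rewrite mxE mulrDl; apply: subringD => //.
rewrite mxE mulr_suml; apply: subring_sum => // k _; rewrite -mulrA.
by apply: subringM => //; apply: congr_one_integral.
Qed.

Lemma congr_subgroupX u k : Gamma u -> Gamma (u ^+ k).
Proof.
move=> Gu; elim: k => [|k IHk]; first exact: congr_subgroup1.
by rewrite exprS; apply: congr_subgroupM.
Qed.

(** The determinant is congruent to 1, hence a unit of [O], and the adjugate formula makes [L u^-1]
    integral; then use [L u^-1 - 1 = - (L u - 1) * L u^-1]. *)
Lemma congr_subgroupV u : u \is a GRing.unit -> Gamma u -> Gamma u^-1.
Proof.
move=> uU Gu; have Odet := det_congr_one Gu.
have := valuation_unit vO nOrho Odet; rewrite addrC subrK => -[det_neq0 OdetV].
have LV : L u *m L u^-1 = 1%:M by rewrite -[_ *m _]/(_ * _) -rmorphM divrr // rmorph1.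
have OLV i j : O (L u^-1 i j).
  have -> : L u^-1 = (\det (L u))^-1 *: \adj (L u).
    rewrite -[\adj _]mulmx1 -LV mulmxA mul_adj_mx mul_scalar_mx scalerA mulVf //.
    by rewrite scale1r.
  rewrite !mxE; apply: subringM => //; apply: subringM => //.
    by apply: subringX => //; apply: subringN => //; apply: subring1.
  by apply: det_integral => k l; rewrite !mxE; apply: congr_one_integral.
move=> i j; have -> : L u^-1 - 1%:M = - ((L u - 1%:M) *m L u^-1).
  by rewrite mulmxBl LV mul1mx opprB.
rewrite mxE mulNr; apply: subringN => //; rewrite mxE mulr_suml.
by apply: subring_sum => // k _; rewrite mulrAC; apply: subringM.
Qed.

Hypothesis rhoP : forall l, prime l -> l%:R != 0 :> F -> ~ O (l%:R / rho).

Lemma congr_subgroup_prime_torsion_free l c :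
  prime l -> Gamma c -> c ^+ l = 1 -> c = 1.
Proof.
move=> l_pr Gc cl; apply/eqP; rewrite -subr_eq0; apply/negPn/negP => c_neq1.
(* If [l] vanishes in [F] it vanishes in [D], and Frobenius gives [(c - 1) ^+ l = c ^+ l - 1 = 0],
   impossible for a unit [c - 1]. *)
have [l0|l_neq0] := eqVneq (l%:R : F) 0.
  have lD : l \in [pchar D].
    rewrite inE l_pr /=; apply/negPn/negP => /hD lU.
    have := rmorph_unit L lU; rewrite rmorph_nat.
    by rewrite -(scaler_nat l) l0 scale0r unitr0.
  have := pFrobenius_autB_comm lD (commr1 c).
  rewrite !pFrobenius_autE cl expr1n subrr => c0.
  by have := unitrX l (hD c_neq1); rewrite c0 unitr0.
(* [1 + c + ... + c^(l-1)] is congruent to [l] and vanishes if [c <> 1] *)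
pose S := \sum_(i < l) c ^+ i.
have S0 : S = 0.
  apply: (mulrI (hD c_neq1)); rewrite mulr0.
  by rewrite /S -subrX1 cl subrr.
apply: (rhoP l_pr l_neq0).
have LS : \sum_(i < l) (L (c ^+ i) - 1%:M) = - l%:R%:M.
  rewrite sumrB -rmorph_sum -/S S0 rmorph0 sub0r sumr_const card_ord.
  by rewrite -scaler_nat scale_scalar_mx mulr1.
have -> : l%:R / rho = - \sum_(i < l) (L (c ^+ i) - 1%:M) ord0 ord0 / rho :> F.
  by rewrite -mulr_suml -summxE LS !mxE eqxx mulNr opprK.
by apply: subringN => //; apply: subring_sum => // i _; apply: congr_subgroupX.
Qed.

Lemma congr_subgroup_torsion_free k c : (0 < k)%N -> Gamma c -> c ^+ k = 1 -> c = 1.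
Proof.
elim/ltn_ind: k c => k IHk c k_gt0 Gc ck.
have [k1|k_gt1] := leqP k 1.
  by move: ck; have -> : k = 1%N by case: k k_gt0 k1 {IHk} => [|[]].
have pr_l := pdiv_prime k_gt1; have /dvdnP [q kE] := pdiv_dvd k.
have q_gt0 : (0 < q)%N by case: q kE k_gt0 => // ->.
apply: (IHk q) => //; first by rewrite [X in (_ < X)%N]kE ltn_Pmulr ?prime_gt1.
apply: (congr_subgroup_prime_torsion_free pr_l); rewrite -?exprM -?kE //.
exact: congr_subgroupX.
Qed.

End CongruenceSubgroup.

(** * Iterated commutators *)

Fixpoint iter_comm (D : unitRingType) (x y : D) k :=
  if k is k'.+1 then let c := iter_comm x y k' in x * c * x^-1 * c^-1 else y.

Lemma iter_comm_unit (D : unitRingType) (x y : D) k :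
  x \is a GRing.unit -> y \is a GRing.unit -> iter_comm x y k \is a GRing.unit.
Proof. by move=> xU yU; elim: k => //= k IHk; rewrite !unitrMl ?unitrV. Qed.

Section RadicalElement.
Variables (D : unitRingType) (K : fieldType) (iota : {rmorphism K -> D}) (d : nat).
Variable L : {rmorphism D -> 'M[K]_d.+1}.
Hypotheses (hD : division_ring D) (iotaE : range iota = center D).
Hypothesis Liota : forall a, L (iota a) = a%:M.
Variables (x : D) (n r : nat).
Hypotheses (xU : x \is a GRing.unit) (n_gt0 : (0 < n)%N) (xnC : center D (x ^+ n)).
Hypothesis radical : forall y, y \is a GRing.unit ->
  exists2 m, (0 < m)%N & center D (iter_comm x y r.+1 ^+ m).

Lemma det_iter_comm y k : y \is a GRing.unit -> \det (L (iter_comm x y k.+1)) = 1.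
Proof.
move=> yU /=; set w := iter_comm x y k.
have wU : w \is a GRing.unit by apply: iter_comm_unit.
have detV u : u \is a GRing.unit -> \det (L u) * \det (L u^-1) = 1.
  by move=> uU; rewrite -det_mulmx -[_ *m _]/(_ * _) -rmorphM divrr // rmorph1 det1.
rewrite !rmorphM !detM [\det (L x) * _]mulrC -[\det (L w) * _ * _]mulrA detV // mulr1.
exact: detV.
Qed.

(** If a power of the commutator is [iota a], its determinant [a ^+ d.+1] is 1; this is where the
    factor [d.+1] in the exponent comes from. *)
Lemma iter_comm_torsion y : y \is a GRing.unit ->
  exists2 m, (0 < m)%N & iter_comm x y r.+1 ^+ m = 1.
Proof.
move=> yU; have [m m_gt0] := radical yU; rewrite -iotaE => -[a _ aE].
exists (m * d.+1)%N; rewrite ?muln_gt0 ?m_gt0 // exprM -aE -rmorphXn.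
suff -> : a ^+ d.+1 = 1 by rewrite rmorph1.
rewrite -det_scalar -Liota aE rmorphXn.
elim: (m) => [|k IHk]; first by rewrite expr0; apply: det1.
by rewrite exprS detM det_iter_comm // mul1r.
Qed.

Section TorsionFree.
Variable G : set D.
Hypothesis GM : forall u v, G u -> G v -> G (u * v).
Hypothesis GV : forall u, u \is a GRing.unit -> G u -> G u^-1.
Hypothesis Gtf : forall k c, (0 < k)%N -> G c -> c ^+ k = 1 -> c = 1.
Variable y : D.
Hypothesis yU : y \is a GRing.unit.
Hypothesis Gy : forall i, (i <= r.+1)%N -> G (x ^+ i * y * x ^- i).

(** [G] need not be stable under conjugation by [x]. Each commutator uses up one conjugation, so the
    conjugates of [y] up to exponent [r.+1] suffice. *)
Let Gcomm k j : (k + j <= r.+1)%N -> G (x ^+ j * iter_comm x y k * x ^- j).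
Proof.
elim: k j => [|k IHk] j; first exact: Gy.
move=> le_kj /=; set c := iter_comm x y k.
have cU : c \is a GRing.unit by apply: iter_comm_unit.
have xjU : x ^+ j \is a GRing.unit by apply: unitrX.
have -> : x ^+ j * (x * c * x^-1 * c^-1) * x ^- j =
    (x ^+ j.+1 * c * x ^- j.+1) * (x ^+ j * c * x ^- j)^-1.
  rewrite !invrM ?unitrV ?unitrMl // invrK exprSr invrM //.
  by rewrite !mulrA !(mulrVK, divrK).
apply: GM; first by apply: IHk; rewrite addnS.
apply: GV; first by rewrite !unitrMl ?unitrV.
by apply: IHk; apply: leq_trans le_kj; rewrite leq_add2r.
Qed.

Lemma commute_of_torsion_free : x * y = y * x.
Proof.
have Gc k : (k <= r.+1)%N -> G (iter_comm x y k).
  by move=> le_kr; have := @Gcomm k 0 _; rewrite addn0 expr0 invr1 mul1r mulr1; apply.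
have cr1 : iter_comm x y r.+1 = 1.
  by have [m m_gt0] := iter_comm_torsion yU; apply: Gtf => //; apply: Gc.
have descent k : (k < r)%N -> iter_comm x y k.+2 = 1 -> iter_comm x y k.+1 = 1.
  move=> lt_kr.
  have wU : iter_comm x y k \is a GRing.unit by apply: iter_comm_unit.
  have vU : iter_comm x y k.+1 \is a GRing.unit by apply: iter_comm_unit.
  have Gv : G (iter_comm x y k.+1) by apply: Gc; rewrite ltnS ltnW.
  have xw : x * iter_comm x y k = iter_comm x y k.+1 * iter_comm x y k * x.
    by rewrite /= !divrK.
  have -> : iter_comm x y k.+2 =
    x * iter_comm x y k.+1 * x^-1 * (iter_comm x y k.+1)^-1 by [].
  move: (iter_comm x y k) (iter_comm x y k.+1) => w v in wU vU Gv xw *.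
  move=> /(congr1 (fun u => u * v * x)); rewrite mul1r !divrK // => xv.
  have xjw j : x ^+ j * w = v ^+ j * w * x ^+ j.
    elim: j => [|j IHj]; first by rewrite !expr0 mul1r mulr1.
    rewrite exprS -mulrA IHj !mulrA (commrX j xv : x * v ^+ j = _) -[_ * x * w]mulrA xw.
    by rewrite exprSr !mulrA.
  apply: (Gtf n_gt0) => //.
  have xnU : x ^+ n \is a GRing.unit by apply: unitrX.
  apply: (mulIr wU); apply: (mulIr xnU).
  by rewrite -xjw mul1r; apply: xnC.
have c1 : iter_comm x y 1 = 1.
  have : forall k, (k <= r)%N -> iter_comm x y (r - k).+1 = 1.
    elim=> [|k IHk] lt_kr; first by rewrite subn0.
    apply: descent; first by rewrite -subn_gt0 subKn // ltnW.
    by rewrite -subSn // subSS; apply/IHk/ltnW.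
  by move=> /(_ r (leqnn r)); rewrite subnn.
by move: c1 => /= /(congr1 (fun u => u * y * x)); rewrite mul1r !divrK.
Qed.
End TorsionFree.

(** The scalar [t] is a common denominator for the entries, divided by [rho], of the finitely many
    conjugates of [z] that [commute_of_torsion_free] involves. Commuting with [y] amounts to
    commuting with [z], as [iota t] is a central unit. *)
Lemma commute_of_nonintegral (s : K) z : nonintegral s -> x * z = z * x.
Proof.
move=> /nonintegral_valuation [O vO nOs].
have [rho nOrho rhoP] := valuation_modulus vO nOs.
pose l := [seq L (x ^+ (val p.1.1) * z * x ^- (val p.1.1)) p.1.2 p.2 / rho |
  p <- enum {: 'I_r.+2 * 'I_d.+1 * 'I_d.+1}].
have [t t_neq0 [Ot tl]] := valuation_denominator l vO.
have tC u : iota t * u = u * iota t by apply: (iota_comm iotaE).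
pose y := 1 + iota t * z.
have Gy i : (i <= r.+1)%N -> congr_subgroup L O rho (x ^+ i * y * x ^- i).
  move=> le_ir a b; have xiU : x ^+ i \is a GRing.unit by apply: unitrX.
  have -> : x ^+ i * y * x ^- i = 1 + iota t * (x ^+ i * z * x ^- i).
    by rewrite /y mulrDr mulr1 mulrDl divrr // !mulrA tC.
  rewrite rmorphD rmorph1 addrAC subrr add0r rmorphM Liota -[t%:M * _]/(t%:M *m _).
  rewrite mul_scalar_mx mxE -mulrA; apply: tl.
  by apply/mapP; exists (Ordinal (le_ir : (i < r.+2)%N), a, b); rewrite ?mem_enum.
(* If [y = 0], a diagonal entry of the congruence reads [-1 / rho] in [O]. *)
have yU : y \is a GRing.unit.
  apply: hD; apply/eqP => y0; have := Gy 0%N isT ord0 ord0.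
  rewrite y0 mulr0 mul0r rmorph0 sub0r !mxE mulNr mul1r => ON.
  by apply: nOrho; rewrite -[rho^-1]opprK; apply: subringN => //; case: vO.
have : x * y = y * x.
  apply: (@commute_of_torsion_free (congr_subgroup L O rho)) yU Gy.
  - exact: (congr_subgroupM vO nOrho).
  - exact: (congr_subgroupV vO nOrho).
  - exact: (congr_subgroup_torsion_free hD vO nOrho rhoP).
rewrite mulrDr mulrDl mulr1 mul1r => /addrI; rewrite mulrA -tC -!mulrA => /mulrI; apply.
by rewrite rmorph_unit ?unitfE.
Qed.
End RadicalElement.

(** * Fields integral over the integers *)

Section FiniteCommutative.
Variables (D : unitRingType) (P : {pred D}) (T : finType) (h : D -> T).
Hypotheses (hD : division_ring D) (Pclosed : divring_closed P).
Hypothesis h_inj : {in P &, injective h}.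

HB.instance Definition _ := GRing.isDivringClosed.Build D P Pclosed.

Definition finite_sub_divring of divring_closed P & {in P &, injective h} := {x : D | P x}.
Local Notation R := (finite_sub_divring Pclosed h_inj).
HB.instance Definition _ := SubChoice.on R.
HB.instance Definition _ := [SubChoice_isSubUnitRing of R by <:].

(** As [h] is injective on [P] only, a classically chosen partial inverse transfers finiteness from
    [T]. *)
Let decode (t : T) : option R :=
  if pselect (exists r : R, h (val r) = t) is left ex then Some (projT1 (cid ex)) else None.

Let codeK : pcancel (fun r : R => h (val r)) decode.
Proof.
move=> r; rewrite /decode; case: pselect => [ex|]; last by case; exists r.
congr Some; case: cid => r' /= e; apply/val_inj/h_inj => //; exact: valP.
Qed.

HB.instance Definition _ := PCanIsCountable codeK.
HB.instance Definition _ : isFinite R := @PCanIsFinite R T _ _ codeK.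

(** Wedderburn's little theorem, for the finite domain [R]. *)
Lemma finite_divring_commutative : {in P &, commutative (@GRing.mul D)}.
Proof.
have domR : GRing.integral_domain_axiom R.
  move=> x y xy0; have [//|/=] := eqVneq x 0.
  rewrite -(inj_eq val_inj) rmorph0 => /hD xU.
  rewrite -(inj_eq val_inj) rmorph0 -(mulKr xU (val y)) -rmorphM xy0.
  by rewrite rmorph0 mulr0.
move=> x y Px Py.
by have := congr1 val (@finDomain_mulrC R domR (exist _ x Px) (exist _ y Py)).
Qed.
End FiniteCommutative.

Section IntegralField.
Variable K : fieldType.
Hypothesis Kint : forall s : K, ~ nonintegral s.

Let integralE (s : K) : exists q : {poly int}, s = (map_poly intr q).[s^-1].
Proof. by apply: contrapT => /forallNP; apply: Kint. Qed.

(** Integrality of [1/2] makes it equal to an integer [N] in [K], so the nonzero integer [2 * N - 1]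
    vanishes in [K]. *)
Lemma integral_pchar : exists p, p \in [pchar K].
Proof.
have [two0|two_neq0] := eqVneq (2%:R : K) 0; first by exists 2; rewrite inE two0 eqxx.
have [q] := integralE (2%:R : K)^-1.
rewrite invrK -[X in _.[X]](rmorph_nat (intr : {rmorphism int -> K})) horner_map /=.
set N := q.[_] => NE.
have [M M_neq0 M0] : exists2 M : int, M != 0 & M%:~R = 0 :> K.
  exists (2 * N - 1); first by apply/eqP; lia.
  by rewrite rmorphB rmorphM /= -NE rmorph_nat rmorph1 divff // subrr.
have [||p pK] := @natf0_pchar K (absz M); [by rewrite absz_gt0| |by exists p].
by case: M M0 {M_neq0} => m; rewrite ?NegzE ?rmorphN => /eqP; rewrite ?oppr_eq0.
Qed.

(** Multiply [s = q.[s^-1]] by [s ^+ k]; the polynomial [g] is [q] with its coefficients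
    reversed. *)
Lemma integral_monic (s : K) :
  exists2 M : {poly int}, M \is monic & root (map_poly intr M) s.
Proof.
have [->|s_neq0] := eqVneq s 0.
  by exists 'X; rewrite ?monicX // map_polyX rootX.
have [q sE] := integralE s; pose k := size q.
pose g := \poly_(j < k.+1) q`_(k - j).
exists ('X^(k.+1) - g).
  rewrite monicE lead_coefDl ?lead_coefXn // size_polyXn size_polyN.
  by rewrite ltnS size_poly.
rewrite rmorphB /= map_polyXn rootE hornerD hornerN hornerXn subr_eq0; apply/eqP.
rewrite exprSr {2}sE !(@horner_coef_wide _ k.+1); last 2 first.
- by apply: leq_trans (size_poly _ _) _; apply: size_poly.
- by apply: leq_trans (size_poly _ _) _; apply: leqnSn.
rewrite mulr_sumr (reindex_inj rev_ord_inj) /=; apply: eq_bigr => i _.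
have le_ik : (i <= k)%N by rewrite -ltnS.
rewrite !coef_map coef_poly ltn_ord subSS mulrCA; congr (_ * _).
by rewrite exprVn -expfB_cond ?(negPf s_neq0) ?leq_subr // subKn.
Qed.
End IntegralField.

(** * Fixed points of powers of Frobenius *)

Section Frobenius.
Variables (K : fieldType) (p : nat).
Hypothesis charKp : p \in [pchar K].

Let p_pr : prime p := pcharf_prime charKp.

Lemma frob_exprB e (x y : K) : (x - y) ^+ (p ^ e) = x ^+ (p ^ e) - y ^+ (p ^ e).
Proof.
have pe : [pchar K].-nat (p ^ e)%N by rewrite pnatX (eq_pnat _ (pcharf_eq charKp)) pnat_id.
by rewrite exprDn_pchar // exprNn_pchar.
Qed.

Lemma frob_inj e : injective (fun x : K => x ^+ (p ^ e)).
Proof.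
move=> x y /eqP; rewrite -subr_eq0 -frob_exprB expf_eq0 => /andP[_].
by rewrite subr_eq0 => /eqP.
Qed.

(** Division by [M] and reduction of coefficients modulo [p] leave finitely many values for the
    powers of [a]. Hence two iterates [a ^+ (p ^ i)] coincide, and injectivity of Frobenius cancels
    the smaller exponent. *)
Lemma integral_frob_fixed (M : {poly int}) (a : K) :
    M \is monic -> root (map_poly intr M) a ->
  exists2 e, (0 < e)%N & a ^+ (p ^ e) = a.
Proof.
move=> Mmonic /rootP Ma; pose m := size M.
have power N : exists g : {ffun 'I_m -> 'I_p}, a ^+ N = \sum_i (g i)%:R * a ^+ i.
  pose c := Pdiv.Ring.rmodp 'X^N M.
  have p_neq0 : (p : int) != 0 by rewrite eqz_nat -lt0n prime_gt0.
  have lt_mod i : (`|(c`_i %% p)%Z| < p)%N.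
    by rewrite -ltz_nat gez0_abs ?modz_ge0 // ltz_pmod // ltz_nat prime_gt0.
  exists [ffun i : 'I_m => Ordinal (lt_mod i)].
  have -> : a ^+ N = (map_poly intr c).[a].
    have := congr1 (fun q => (map_poly intr q).[a]) (Pdiv.RingMonic.rdivp_eq Mmonic 'X^N).
    by rewrite /= rmorphD rmorphM /= hornerD hornerM Ma mulr0 add0r map_polyXn hornerXn.
  rewrite (@horner_coef_wide _ m); last first.
    apply: leq_trans (size_poly _ _) _; apply: ltnW.
    by rewrite Pdiv.Ring.ltn_rmodpN0 ?monic_neq0.
  apply: eq_bigr => i _; rewrite coef_map ffunE /=; congr (_ * _).
  rewrite {1}(divz_eq c`_i p) rmorphD rmorphM /= -[p%:~R]/(p%:R) (pcharf0 charKp).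
  by rewrite mulr0 add0r -[in LHS](gez0_abs (modz_ge0 c`_i p_neq0)).
have fixed i j : (i < j)%N -> a ^+ (p ^ i) = a ^+ (p ^ j) ->
    exists2 e, (0 < e)%N & a ^+ (p ^ e) = a.
  move=> lt_ij aij; exists (j - i)%N; first by rewrite subn_gt0.
  by apply: (@frob_inj i); rewrite -exprM -expnD subnK // ltnW.
have /choice [g gE] := power.
have /existsNP [i /existsNP [j /not_implyP [gij neq_ij]]] :
    ~ injective (fun i : 'I_#|{ffun 'I_m -> 'I_p}|.+1 => g (p ^ i)%N).
  by move/leq_card; rewrite card_ord ltnn.
have aij : a ^+ (p ^ i) = a ^+ (p ^ j) by rewrite !gE gij.
have [/fixed|/fixed|/val_inj//] := ltngtP i j; apply; by rewrite aij.
Qed.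

Lemma common_frob_fixed (I : eqType) (r : seq I) (f : I -> K) :
    (forall a : K, exists2 e, (0 < e)%N & a ^+ (p ^ e) = a) ->
  exists2 e, (0 < e)%N & forall i, i \in r -> f i ^+ (p ^ e) = f i.
Proof.
move=> fixed.
have iter_fixed a e k : a ^+ (p ^ e) = a :> K -> a ^+ (p ^ (e * k)) = a.
  move=> ae; elim: k => [|k IHk]; first by rewrite muln0 expr1.
  by rewrite mulnS expnD exprM ae.
elim: r => [|i r [e e_gt0 eP]]; first by exists 1%N.
have [e' e'_gt0 e'P] := fixed (f i).
exists (e' * e)%N => [|j]; first by rewrite muln_gt0 e'_gt0.
by rewrite inE => /orP[/eqP ->|/eP jP]; [|rewrite mulnC]; apply: iter_fixed.
Qed.

Definition frob_iter of p \in [pchar K] := fun e (a : K) => a ^+ (p ^ e).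

Fact frob_iter_zmod_morphism e : zmod_morphism (frob_iter charKp e).
Proof. exact: frob_exprB. Qed.

Fact frob_iter_monoid_morphism e : monoid_morphism (frob_iter charKp e).
Proof. by split=> [|a b]; rewrite /frob_iter ?expr1n ?exprMn. Qed.

HB.instance Definition _ e :=
  GRing.isZmodMorphism.Build K K (frob_iter charKp e) (frob_iter_zmod_morphism e).
HB.instance Definition _ e :=
  GRing.isMonoidMorphism.Build K K (frob_iter charKp e) (frob_iter_monoid_morphism e).

(** The fixed elements are roots of [Q], nonzero because [0 < e]; a duplicate-free list of roots of
    maximal length contains them all. *)
Lemma frob_fixed_finite e : (0 < e)%N ->
  exists s : seq K, forall a, frob_iter charKp e a = a -> a \in s.
Proof.
move=> e_gt0; pose Q := 'X^(p ^ e) - 'X : {poly K}.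
have q_gt1 : (1 < p ^ e)%N by rewrite -(expn0 p) ltn_exp2l ?prime_gt1.
have Q_neq0 : Q != 0.
  by rewrite -size_poly_gt0 size_polyDl size_polyXn // size_polyN size_polyX.
pose P k := `[< exists s : seq K, [/\ size s = k, uniq s & all (root Q) s] >].
have exP : exists k, P k by exists 0%N; apply/asboolP; exists [::].
have leP k : P k -> (k <= size Q)%N.
  by move=> /asboolP [s [<- us rs]]; apply/ltnW/max_poly_roots.
case: (ex_maxnP exP leP) => k /asboolP [s [sk us rs]] kmax; exists s => a aE.
apply/negPn/negP => a_notin; have := kmax k.+1; rewrite ltnn => /(_ _)/negP; apply=> //.
apply/asboolP; exists (a :: s); split; rewrite /= ?sk ?a_notin //.
rewrite rs andbT rootE /Q hornerD hornerN hornerXn hornerX.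
by rewrite -[a ^+ _]/(frob_iter charKp e a) aE subrr.
Qed.
End Frobenius.

(** One power [phi] of Frobenius fixes all entries of [L x] and [L z]. The elements whose matrices
    are fixed by [phi] form a division subring, finite because [L] is injective and [phi] has
    finitely many fixed points. *)
Lemma integral_commutative (D : unitRingType) (K : fieldType) d
    (L : {rmorphism D -> 'M[K]_d.+1}) :
  division_ring D -> (forall s : K, ~ nonintegral s) -> commutative (@GRing.mul D).
Proof.
move=> hD Kint x z; have [p charKp] := integral_pchar Kint.
have fixed a : exists2 e, (0 < e)%N & a ^+ (p ^ e) = a :> K.
  by have [M Mmonic Ma] := integral_monic Kint a; apply: integral_frob_fixed Ma.
have [e e_gt0 eP] := common_frob_fixed (enum {: bool * 'I_d.+1 * 'I_d.+1})
  (fun i => L (if i.1.1 then x else z) i.1.2 i.2) fixed.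
pose phi : {rmorphism K -> K} := frob_iter charKp e.
pose P : {pred D} := fun u => map_mx phi (L u) == L u.
have Pclosed : divring_closed P.
  split=> [|u v /eqP Pu /eqP Pv|u v /eqP Pu /eqP Pv]; apply/eqP.
  - by rewrite rmorph1 map_mx1.
  - by rewrite rmorphB map_mxB Pu Pv.
  rewrite rmorphM map_mxM Pu; congr (_ *m _).
  have [->|v_neq0] := eqVneq v 0; first by rewrite invr0 rmorph0 map_mx0.
  by rewrite rmorphV ?hD // map_invmx Pv.
have L_inj u v : L u = L v -> u = v.
  move=> Luv; apply/eqP; rewrite -subr_eq0; apply/negPn/negP => /hD/(rmorph_unit L).
  by rewrite rmorphB Luv subrr unitr0.
have [s sP] := frob_fixed_finite charKp e_gt0.
(* A matrix is coded by the positions of its entries in [s]. *)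
pose h u := [ffun ij : 'I_d.+1 * 'I_d.+1 =>
  inord (index (L u ij.1 ij.2) s) : 'I_(size s).+1].
have hinj : {in P &, injective h}.
  move=> u v /eqP Pu /eqP Pv /ffunP huv; apply/L_inj/matrixP => i j.
  have fixu w : map_mx phi (L w) = L w -> L w i j \in s.
    by move=> /matrixP /(_ i j); rewrite mxE => /sP.
  have := congr1 (@nat_of_ord _) (huv (i, j)).
  rewrite !ffunE /= !inordK ?ltnS ?index_size // => ij.
  by rewrite -(nth_index 0 (fixu u Pu)) ij nth_index // fixu.
apply: (finite_divring_commutative hD Pclosed hinj); apply/eqP/matrixP => i j; rewrite mxE.
  by have := eP (true, i, j); rewrite mem_enum; apply.
by have := eP (false, i, j); rewrite mem_enum; apply.
Qed.

(** * Subnormal subgroups *)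

Lemma linear_radical_central (D : unitRingType) (x : D) n r :
    division_ring D -> linear_divring D -> x \is a GRing.unit -> (0 < n)%N ->
    center D (x ^+ n) ->
    (forall y, y \is a GRing.unit ->
      exists2 m, (0 < m)%N & center D (iter_comm x y r.+1 ^+ m)) ->
  center D x.
Proof.
move=> hD linD xU n_gt0 xnC radical z.
have [K [iota iotaE]] := center_field hD.
have [d [L Liota]] := linear_regular_rep hD iotaE linD.
have [[s sN]|/forallNP Kint] := pselect (exists s : K, nonintegral s).
  exact: (commute_of_nonintegral hD iotaE Liota xU n_gt0 xnC radical z sN).
exact: (integral_commutative L hD Kint).
Qed.

(** After [k] steps the commutator is in [G (r - k)], so [r] steps reach [N]. The extra step
    guarantees a genuine commutator, of determinant 1, even when [r = 0]. *)
Lemma subnormal_iter_comm (D : unitRingType) (N : set D) : subnormal N ->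
  exists r, forall x y, N x -> y \is a GRing.unit -> N (iter_comm x y r.+1).
Proof.
case=> r [G [G0 Gr Gn]].
have memV (H : set D) : unit_subgroup H -> forall u v, H u -> H v -> H (u / v).
  by move=> [_ [_ Hdiv]] u v /mem_set Hu /mem_set Hv; apply/set_mem/Hdiv.
have mem1 (H : set D) : unit_subgroup H -> H 1 by move=> [_ [H1 _]]; apply: set_mem.
have memM (H : set D) : unit_subgroup H -> forall u v, H u -> H v -> H (u * v).
  move=> sH u v Hu Hv; rewrite -[v]invrK; apply: (memV _ sH) => //.
  by rewrite -div1r; apply: (memV _ sH) => //; apply: mem1.
have unitG : unit_subgroup (unit_group (D := D)).
  split=> //; split=> [|u v /set_mem uU /set_mem vU]; apply/mem_set; first exact: unitr1.
  by rewrite /unit_group /= unitrMl // unitrV.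
have sG i : (i <= r)%N -> unit_subgroup (G i).
  by rewrite leq_eqVlt => /orP[/eqP ->|/Gn []//]; rewrite Gr.
exists r => x y Nx yU.
have Gx i : (i <= r)%N -> G i x.
  elim: i => [|i IHi] le_ir; first by rewrite G0.
  by have [_ _ sub _] := Gn i le_ir; apply/sub/IHi/ltnW.
have Gc k : (k <= r)%N -> G (r - k)%N (iter_comm x y k).
  elim: k => [|k IHk] lt_kr; first by rewrite subn0 Gr.
  have := IHk (ltnW lt_kr); rewrite -subnSK //= => Gk.
  have lt_i : (r - k.+1 < r)%N by rewrite ltn_subrL (leq_ltn_trans _ lt_kr).
  have [sGi sGk _ nG] := Gn _ lt_i; set c := iter_comm x y k.
  have GcV : G (r - k.+1).+1 c^-1 by rewrite -div1r; apply: (memV _ sGk) => //; apply: mem1.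
  have GxV : G (r - k.+1)%N x^-1.
    by rewrite -div1r; apply: (memV _ sGi); [apply: mem1|apply/Gx/ltnW].
  rewrite -!mulrA; apply: (memM _ sGi); first exact/Gx/ltnW.
  (* Read [x * c * x^-1 * c^-1] as [x] times the conjugate [c * x^-1 * c^-1], which normality keeps
     in the smaller group. *)
  by have := nG _ _ GxV GcV; rewrite invrK mulrA.
have := Gc r (leqnn r); rewrite subnn G0 => Nc.
have sN : unit_subgroup N by rewrite -G0; apply: sG.
by rewrite /=; apply: (memV _ sN) => //; apply: (memV _ sN) => //; apply: (memM _ sN).
Qed.

(** * Reduction to a finitely generated division subring *)

Lemma gen_divring_division (D : unitRingType) (S : seq D) :
  division_ring D -> division_ring (gen_divring_type S).
Proof.
move=> hD x; rewrite -(inj_eq val_inj) rmorph0 => /hD xU.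
have xV : gen_divring_pred S (val x)^-1 by apply: rpredVr (valP x).
apply/unitrP; exists (Sub _ xV : gen_divring_type S).
by split; apply/val_inj; rewrite rmorphM rmorph1 /= ?mulVr ?mulrV.
Qed.

Lemma val_iter_comm (D : unitRingType) (S : seq D) (x y : gen_divring_type S) k :
    division_ring D -> x \is a GRing.unit -> y \is a GRing.unit ->
  val (iter_comm x y k) = iter_comm (val x) (val y) k.
Proof.
move=> hD xU yU; elim: k => // k IHk.
rewrite -[iter_comm x y k.+1]/(x * iter_comm x y k * x^-1 * (iter_comm x y k)^-1).
by rewrite !rmorphM !rmorphV ?iter_comm_unit // [RHS]/iter_comm -/iter_comm -IHk.
Qed.
Theorem theorem3p3 (D : unitRingType) (N : set D)
    (hD : division_ring D) (hlin : locally_linear D)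
    (hN : subnormal N) (hrad : radical_over N (center D)) :
  (N `<=` center D)%classic.
Proof.
move=> x Nx z; have [r Ncomm] := subnormal_iter_comm hN.
have xU : x \is a GRing.unit.
  have [r0 [G [G0 Gr Gn]]] := hN.
  case: r0 Gr Gn => [|r0] Gr Gn; first by have : unit_group x by rewrite -Gr G0.
  by have [[sub _] _ _ _] := Gn 0%N isT; apply: sub; rewrite G0.
(* Commutation with a single [z] can be tested in the division subring generated by [x] and [z],
   which is linear. *)
pose S := [:: x; z].
have memS u : u \in S -> gen_divring_pred S u.
  by move=> uS; apply/mem_set => A [_]; apply.
have xS : gen_divring_pred S x by apply: memS; rewrite mem_head.
have zS : gen_divring_pred S z by apply: memS; rewrite mem_behead ?mem_head.
pose x1 : gen_divring_type S := Sub x xS.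
pose z1 : gen_divring_type S := Sub z zS.
have hD1 := @gen_divring_division D S hD.
have lift_center (u : gen_divring_type S) : center D (val u) -> center _ u.
  by move=> uC v; apply/val_inj; rewrite !rmorphM; apply: uC.
have x1U : x1 \is a GRing.unit.
  apply: hD1; rewrite -(inj_eq val_inj) rmorph0.
  by apply: contraTneq xU => /= ->; rewrite unitr0.
have [n [n_gt0 xnC]] := hrad x Nx.
suff : center _ x1 by move=> /(_ z1)/(congr1 val); rewrite /GRing.comm !rmorphM.
apply: (@linear_radical_central _ x1 n r) => //; first exact: hlin.
  by apply: lift_center; rewrite rmorphXn.
(* [N] is subnormal in the units of [D], not of the subring: the commutator is formed in [D], and
   only the centrality of its power is brought back. *)
move=> y yU; have vyU : val y \is a GRing.unit by apply: rmorph_unit.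
have [m [m_gt0 mC]] := hrad _ (Ncomm x (val y) Nx vyU).
by exists m => //; apply: lift_center; rewrite rmorphXn /= val_iter_comm.
Qed.
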